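(* Let $K$ be a convex cone in a finite-dimensional Euclidean space $E$ and let $V\subseteq E$ be a (real) algebraic variety. Then for any $A\in K$ we have $\operatorname{rank}_{K,V}(A)\ \ge\ \tau_{K,V}(A)$.
   Context: A convex cone is closed under addition and under multiplication by nonnegative scalars (in particular it contains $0$). For $x,y\in E$ write $x\preceq_K y$ if $y-x\in K$. For $A\in K$, $\operatorname{rank}_{K,V}(A)$ (the atomic rank) is the smallest integer $r$ for which one can write $A=\sum_{i=1}^r R_i$ with each $R_i\in K\cap V$ (it is $+\infty$ if no such decomposition exists). Define $\mathcal A_{K,V}(A)=\{R\in V : 0\preceq_K R\preceq_K A\}$ and $$\tau_{K,V}(A)=\sup\{L(A) : L \text{ a linear functional on } E \text{ with } L(R)\le 1 \text{ for all } R\in\mathcal A_{K,V}(A)\}$$ (the paper writes this supremum as a maximum). *)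

(* Defs.v *)
(* mpoly is required but not imported: its notations clash with those of
   MathComp-Analysis. *)
From HB Require Import structures.
From mathcomp Require Import all_boot all_order all_algebra.
From mathcomp Require Import boolp classical_sets reals ereal.
From mathcomp Require mpoly.

Set Implicit Arguments.
Unset Strict Implicit.
Unset Printing Implicit Defensive.

Import Order.TTheory GRing.Theory Num.Theory.

Local Open Scope classical_set_scope.
Local Open Scope ring_scope.

Section AtomicRank.
Variables (R : realType) (E : vectType R).
Implicit Types (K V : set E) (A X Y : E).

Definition convex_cone K : Prop :=
  [/\ K 0, (forall X Y, K X -> K Y -> K (X + Y)) &
      (forall (t : R) X, 0 <= t -> K X -> K (t *: X))].

Definition cone_le K X Y : Prop := K (Y - X).

(* Value at [X] of the polynomial [p], in coordinates with respect to the basis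
   [vbasis {:E}].  The class of polynomial functions on [E] does not depend on
   the choice of the basis. *)
Definition poly_eval (p : mpoly.mpoly (\dim {:E}) R) X : R :=
  mpoly.meval (fun i : 'I_(\dim {:E}) => coord (vbasis {:E}) i X) p.

(* Zero locus of a set of polynomials, not assumed irreducible.  Arbitrary and
   finite sets give the same varieties, by Hilbert's basis theorem. *)
Definition algebraic_variety V : Prop :=
  exists I : set (mpoly.mpoly (\dim {:E}) R),
    V = [set X | forall p, I p -> poly_eval p X = 0].

Definition atomic_decomposition K V A (r : nat) : Prop :=
  exists X : 'I_r -> E,
    (forall i, (K `&` V) (X i)) /\ A = \sum_(i < r) X i.

Definition atomic_rank K V A : \bar R :=
  if pselect (exists r, `[< atomic_decomposition K V A r >]) is left ex_r
  then ((ex_minn ex_r)%:R)%:E else +oo%E.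

Definition atoms_below K V A : set E :=
  [set X | V X /\ cone_le K 0 X /\ cone_le K X A].

Definition tau K V A : \bar R :=
  ereal_sup [set (L A)%:E | L in
    [set L : {scalar E} | forall X, atoms_below K V A X -> L X <= 1]].

End AtomicRank.

(* Main.v *)
(* In a decomposition of A into r atoms, each atom is below A, since the
   difference is the sum of the other atoms.  So a feasible functional L is at
   most 1 on each of them, and L A <= r by linearity. *)
Require Import Defs.
From mathcomp Require Import all_boot all_order all_algebra.
From mathcomp Require Import boolp classical_sets reals ereal.

Import Order.TTheory GRing.Theory Num.Theory.
Local Open Scope ring_scope.

(** The filter [P] lets this apply to a sum with one index left out, the form of the gap between [A]
    and one of its atoms. *)
Lemma convex_cone_sum (R : realType) (E : vectType R) (K : set E)
    (I : finType) (P : pred I) (X : I -> E) :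
  convex_cone K -> (forall i, K (X i)) -> K (\sum_(i | P i) X i).
Proof. by case=> K0 KD _ KX; apply: big_ind => // i _; exact: KX. Qed.

Lemma atomic_decomposition_below (R : realType) (E : vectType R)
    (K V : set E) (r : nat) (X : 'I_r -> E) (i : 'I_r) :
  convex_cone K -> (forall j, (K `&` V)%classic (X j)) ->
  atoms_below K V (\sum_(j < r) X j) (X i).
Proof.
move=> hK KVX; have [KXi VXi] := KVX i.
split=> //; split; rewrite /cone_le ?subr0 //.
rewrite (bigD1 i) //= addrAC subrr add0r.
by apply: convex_cone_sum => // j; have [] := KVX j.
Qed.

Lemma tau_le_decomposition (R : realType) (E : vectType R) (K V : set E)
    (A : E) (r : nat) :
  convex_cone K -> atomic_decomposition K V A r -> (tau K V A <= r%:R%:E)%E.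
Proof.
move=> hK [X [KVX ->]]; apply: ge_ereal_sup => _ [L L_le1 <-].
(* Writing [r] as a sum of [r] ones turns the bound into a termwise comparison. *)
rewrite lee_fin linear_sum -[in leRHS](card_ord r) -sumr_const.
by apply: ler_sum => i _; apply: L_le1; exact: atomic_decomposition_below.
Qed.

Theorem theorem1 (R : realType) (E : vectType R) (ip : {dot E for idfun})
    (K V : set E) (hK : convex_cone K) (hV : algebraic_variety V)
    (A : E) (hA : K A) :
  (tau K V A <= atomic_rank K V A)%E.
Proof.
rewrite /atomic_rank; case: pselect => [ex_r|_]; last exact: leey.
(* The least length is attained by an actual decomposition, so the bound for decompositions applies
   to it. *)
by case: ex_minnP => r /asboolP Ar _; exact: tau_le_decomposition.
Qed.
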